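(* Let $p$ be a prime, $d\ge 2$ an integer, $F$ an ordered basis of $\mathbb F_p^{\mathbb N}$, and $k\in\mathbb N$. Let $w(a)=w_{F,d}(a)$ $(a\in\mathbb N)$ be the lexicographic words, $\mathrm{Lex}_{F,d}(k)=\{w(0),w(1),\dots,w(p^k-1)\}$ the lexicographic code, and $w^+(a)=\sum_{i\in\mathbb N}a_i\,w(p^i)$, where $a=\sum_i a_ip^i$ with $a_i\in\{0,\dots,p-1\}$ is the $p$-ary expansion of $a$. Then the following three conditions are equivalent. (1) $\mathrm{Lex}_{F,d}(k)$ is a linear code (i.e. an $\mathbb F_p$-linear subspace of $\mathbb F_p^{\mathbb N}$). (2) $w(a)=w^+(a)$ for all $0\le a<p^k$. (3) $w(a)=w^+(a)$ for all $0\le a<p^k$ with $\sum_{i\in\mathbb N}a_i\le p-1$ (the sum taken in the integers).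
   Context: $\mathbb N$ is the set of non-negative integers. $\mathbb F_p$ is identified with $\{0,1,\dots,p-1\}$, and its elements are compared as integers. $\mathbb F_p^{\mathbb N}$ denotes the $\mathbb F_p$-vector space of sequences $(x_i)_{i\in\mathbb N}$ with $x_i\in\mathbb F_p$ and $x_i=0$ for all but finitely many $i$. For an ordered basis $F=(f_i)_{i\in\mathbb N}$ of $\mathbb F_p^{\mathbb N}$ write $x=\sum_i x_{[i]}f_i$. The total order $<_F$ on $\mathbb F_p^{\mathbb N}$ is: for $x\ne y$, let $N$ be the largest index with $x_{[N]}\neq y_{[N]}$; then $x<_F y$ iff $x_{[N]}<y_{[N]}$. The Hamming distance is $d(x,y)=|\{i\in\mathbb N: x_i\ne y_i\}|$ (with respect to the standard coordinates). The words $w(a)=w_{F,d}(a)$ are defined recursively: $w(a)$ is the minimum, with respect to $<_F$, of all $z\in\mathbb F_p^{\mathbb N}$ such that $d(z,w(b))\ge d$ for all $0\le b<a$. *)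

(* Defs.v *)
From mathcomp Require Import all_boot all_order all_algebra.
From Stdlib Require Import ClassicalEpsilon.

Set Implicit Arguments.
Unset Strict Implicit.
Unset Printing Implicit Defensive.

Import GRing.Theory.
Local Open Scope ring_scope.

(* The space of finitely supported sequences over 'F_p is {poly 'F_p}: an
   element is a list with no trailing zeroes, its i-th standard coordinate is
   x`_i, and the vector space operations are coordinatewise.  The ring
   multiplication of polynomials plays no role. *)

Section LexicographicCodes.

Variables (p : nat) (F : nat -> {poly 'F_p}).

Definition lincomb (c : {poly 'F_p}) : {poly 'F_p} :=
  \sum_(i < size c) c`_i *: F i.

Definition ordered_basis : Prop :=
  (forall c, lincomb c = 0 -> c = 0) /\ (forall x, exists c, x = lincomb c).

(* Here cx and cy are the coordinate sequences of x and y in the basis F, and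
   N is the largest index at which they differ; elements of 'F_p are compared
   through the coercion of 'F_p, as an ordinal type, to nat. *)
Definition lex_lt (x y : {poly 'F_p}) : Prop :=
  exists cx cy : {poly 'F_p},
    [/\ x = lincomb cx, y = lincomb cy &
        exists N : nat, ((cx`_N)%R < (cy`_N)%R)%N /\
          forall i : nat, (N < i)%N -> cx`_i = cy`_i].

Definition is_lex_min (P : {poly 'F_p} -> Prop) (z : {poly 'F_p}) : Prop :=
  P z /\ forall y, P y -> y <> z -> lex_lt z y.

(* Coordinates of index at least maxn (size x) (size y) vanish in both. *)
Definition hamming (x y : {poly 'F_p}) : nat :=
  #|[set i : 'I_(maxn (size x) (size y)) | x`_i != y`_i]|.

Variable d : nat.

Definition next_word (s : seq {poly 'F_p}) : {poly 'F_p} :=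
  epsilon (inhabits 0)
    (is_lex_min (fun z => forall y, y \in s -> (d <= hamming z y)%N)).

(* The list [:: w(0); ...; w(n-1)]. *)
Fixpoint lex_words (n : nat) : seq {poly 'F_p} :=
  if n is m.+1 then rcons (lex_words m) (next_word (lex_words m)) else [::].

Definition lex_word (a : nat) : {poly 'F_p} := next_word (lex_words a).

Definition lex_code (k : nat) : seq {poly 'F_p} :=
  [seq lex_word a | a <- iota 0 (p ^ k)].

Definition digit (a i : nat) : nat := (a %/ p ^ i) %% p.

(* For p > 1 the sums over i < a contain all nonzero digits, as a < p ^ a. *)
Definition digit_sum (a : nat) : nat := (\sum_(i < a) digit a i)%N.

Definition lex_word_plus (a : nat) : {poly 'F_p} :=
  \sum_(i < a) (digit a i)%:R *: lex_word (p ^ i).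

Definition linear_code (C : {pred {poly 'F_p}}) : Prop := submod_closed C.

End LexicographicCodes.

(* Main.v *)
(* (1) => (2) and (3) => (2) go by strong induction on a.  If w = w^+ below a,
   then w^+(a) is at distance at least d from all earlier words: w^+(a) - w^+(b)
   is a nonzero multiple of w(p^i) - w(e), where i is the top digit at which a
   and b differ and e < p^i.  So w(a) = w^+(a) unless z := w(a) <_F w^+(a); let
   N be the top F-coordinate at which z and w^+(a) then differ.

   (3) => (2): as Z/p has Davenport constant p, some b with digits at most those
   of a and digit sum less than p has w^+(b)_[N] = w^+(a)_[N].  Hence
   z - w^+(a - b) <_F w^+(b) = w(b), and it is at distance less than d from some
   w(b') with b' < b.  So z is at distance less than d from w^+(e) = w(e), where
   e is the digitwise sum mod p of a - b and b', and e < a: a contradiction.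

   (1) => (2): y := z - w^+(a) lies in the code and has top coordinate
   u := y_[N].  Whenever p^j <= a and w(p^j)_[N] <> 0, the codeword
   w(p^j) - y/u precedes w(p^j), so it is w^+(b) for some b < p^j, and thus
   y = w^+(e), where e has top digit u, at place j.  This determines j, and
   w(p^j)_[N] = 1, w^+(a)_[N] = a_j, z_[N] = a_j + u < a_j.  The digitwise sum
   of a and e is then less than a, but its word is z = w(a): a contradiction. *)
Require Import Defs.
From mathcomp Require Import all_boot all_order all_algebra.
From Stdlib Require Import ClassicalEpsilon.
From HB Require Import structures.
From mathcomp Require Import zify.

Set Implicit Arguments.
Unset Strict Implicit.
Unset Printing Implicit Defensive.

Import GRing.Theory.
Local Open Scope ring_scope.

(** * Changing the bound of a finite sum; base-q expansions *)

Lemma big_ord_support (R : Type) (idx : R) (op : Monoid.law idx)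
    (f : nat -> R) m n :
  (forall i, (minn m n <= i)%N -> f i = idx) ->
  \big[op/idx]_(i < m) f i = \big[op/idx]_(i < n) f i.
Proof.
wlog le_mn : m n / (m <= n)%N => [H f0|].
  by case/orP: (leq_total m n) => ? ; [|symmetry]; apply: H => //; rewrite minnC.
move/minn_idPl: (le_mn) => -> f0.
rewrite -(subnKC le_mn) big_split_ord /= [X in op _ X]big1 ?Monoid.mulm1 //.
by move=> i _; apply: f0; rewrite leq_addr.
Qed.

Lemma expansion_lt q n (u : 'I_n -> nat) :
  (forall i, u i < q)%N -> (\sum_(i < n) u i * q ^ i < q ^ n)%N.
Proof.
elim: n u => [|n IHn] u ltu; first by rewrite big_ord0.
rewrite big_ord_recr /= expnS.
have ltS := IHn _ (fun i => ltu (widen_ord (leqnSn n) i)).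
by rewrite -addSn (leq_trans (leq_add ltS (leqnn _))) // -mulSn leq_mul2r ltu orbT.
Qed.

(** By [expansion_lt], the digits of [u] below place [N] add up to less than [q ^ N], so a gain of
    one unit at [N] outweighs them. *)
Lemma expansion_lex q n (u v : 'I_n -> nat) (N : 'I_n) :
  (forall i, u i < q)%N -> (u N < v N)%N ->
  (forall i : 'I_n, (N < i)%N -> u i = v i) ->
  (\sum_(i < n) u i * q ^ i < \sum_(i < n) v i * q ^ i)%N.
Proof.
elim: n u v N => [|n IHn] u v N ltu ltN eqN; first by case: N {ltN eqN}.
rewrite !big_ord_recr /=.
have [/= ltNn|geNn] := ltnP N n.
  rewrite eqN // ltn_add2r.
  have eN : widen_ord (leqnSn n) (Ordinal ltNn) = N by apply: val_inj.
  by apply: (IHn _ _ (Ordinal ltNn)) => [i||i lti]; rewrite ?eN //; apply: eqN.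
have eN : N = ord_max.
  by apply/val_inj/eqP; rewrite eqn_leq geNn andbT -ltnS ltn_ord.
have ltS := expansion_lt (fun i => ltu (widen_ord (leqnSn n) i)).
rewrite -addSn (leq_trans (leq_add ltS (leqnn _))) // -mulSn -eN.
by rewrite (leq_trans _ (leq_addl _ _)) // leq_mul2r ltN orbT.
Qed.

Lemma expansion_mod q n a :
  (\sum_(i < n) digit q a i * q ^ i)%N = (a %% q ^ n)%N.
Proof.
elim: n => [|n IHn]; first by rewrite big_ord0 modn1.
rewrite big_ord_recr /= IHn /digit modn_divl -expnS.
have dvq : (q ^ n %| q ^ n.+1)%N by rewrite dvdn_exp2l.
by rewrite -(modn_dvdm a dvq) addnC -divn_eq.
Qed.

(* The pigeonhole principle on prefix sums: p elements of F_p have a nonempty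
   subsequence with sum zero, which can be deleted. *)
Lemma short_subseq_sum p (p_prime : prime p) (I : eqType) (g : I -> 'F_p)
    (s : seq I) :
  exists t, [/\ subseq t s, (size t < p)%N & \sum_(i <- t) g i = \sum_(i <- s) g i].
Proof.
have [n] := ubnP (size s); elim: n s => // n IHn s; rewrite ltnS => les.
have [lts|ges] := ltnP (size s) p; first by exists s.
pose f (m : 'I_p.+1) := \sum_(i <- take m s) g i.
have /injectivePn[m1 [m2 ne_m eq_f]] : ~~ injectiveb f.
  apply/injectiveP=> /leq_card; rewrite card_ord card_Fp //.
  by rewrite ltnn.
wlog lt_m : m1 m2 ne_m eq_f / (m1 < m2)%N.
  have : (m1 != m2 :> nat) by [].
  by rewrite neq_ltn => /orP[] lt_m H; [apply: (H m1 m2)|apply: (H m2 m1)];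
    rewrite // eq_sym.
have le_m2 : (m2 <= size s)%N by rewrite (leq_trans _ ges) // -ltnS.
have sz1 : size (take m1 s) = m1 by rewrite size_takel // ltnW ?(leq_trans lt_m).
have [|t [sub_t lt_t sum_t]] := IHn (take m1 s ++ drop m2 s).
  rewrite size_cat sz1 size_drop.
  move: les le_m2 lt_m; clear; lia.
exists t; split=> //.
  apply: subseq_trans sub_t _; rewrite -[X in subseq _ X](cat_take_drop m1 s).
  apply: cat_subseq => //.
  by rewrite -(subnK (ltnW lt_m)) -drop_drop drop_subseq.
rewrite sum_t -[in RHS](cat_take_drop m2 s) !big_cat /=.
by congr (_ + _).
Qed.

(** * Arithmetic of the integer representatives of residues mod p *)

Section FpDigits.

Variables (p : nat) (p_prime : prime p).

Lemma ltn_Fp (x : 'F_p) : (x < p)%N.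
Proof. by rewrite -[X in (_ < X)%N](Fp_cast p_prime). Qed.

Lemma Fp_valB1 (x : 'F_p) : x != 0 -> ((x - 1)%R < x)%N.
Proof.
move=> x0; have x_gt0 : (0 < x)%N
  by rewrite lt0n; apply: contraNneq x0 => x0; apply/eqP/val_inj.
have -> : x - 1 = (x.-1)%:R.
  by rewrite -[in LHS](natr_Zp x) -{1}(prednK x_gt0) -natr1 addrK.
by rewrite val_Fp_nat // (leq_ltn_trans (leq_mod _ _)) // prednK.
Qed.

Lemma Fp_valB (x y : 'F_p) : (y <= x)%N -> (x - y)%R = (x - y)%N :> nat.
Proof.
move=> le_yx; rewrite -[in LHS](natr_Zp x) -[in LHS](natr_Zp y) -natrB //.
by rewrite val_Fp_nat // modn_small // (leq_ltn_trans (leq_subr _ _)) ?ltn_Fp.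
Qed.

Lemma Fp_valD_le (x y : 'F_p) : ((x + y)%R <= x + y)%N.
Proof. by rewrite -{1}(natr_Zp x) -{1}(natr_Zp y) -natrD val_Fp_nat // leq_mod. Qed.

End FpDigits.

(** * The order given by an ordered basis *)

Section Basis.

Variables (p : nat) (p_prime : prime p) (F : nat -> {poly 'F_p}).
Hypothesis F_basis : ordered_basis F.

Lemma lincomb_widen (c : {poly 'F_p}) n :
  (size c <= n)%N -> lincomb F c = \sum_(i < n) c`_i *: F i.
Proof.
move=> le_n; apply: (@big_ord_support _ 0 +%R (fun i => c`_i *: F i)) => i.
by move/minn_idPl: le_n => -> /(nth_default 0) ->; rewrite scale0r.
Qed.

Lemma lincomb_linear a (b c : {poly 'F_p}) :
  lincomb F (a *: b + c) = a *: lincomb F b + lincomb F c.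
Proof.
pose n := maxn (maxn (size b) (size c)) (size (a *: b + c)).
have le_bn : (size b <= n)%N by rewrite /n !leq_max leqnn.
have le_cn : (size c <= n)%N by rewrite /n !leq_max leqnn orbT.
have le_n : (size (a *: b + c)%R <= n)%N by rewrite leq_maxr.
rewrite (lincomb_widen le_bn) (lincomb_widen le_cn) (lincomb_widen le_n).
rewrite scaler_sumr -big_split /=; apply: eq_bigr => i _.
by rewrite coefD coefZ scalerDl scalerA.
Qed.

Definition coord x : {poly 'F_p} :=
  proj1_sig (constructive_indefinite_description _ (proj2 F_basis x)).

Lemma coordK x : lincomb F (coord x) = x.
Proof. by rewrite /coord; case: constructive_indefinite_description. Qed.

Lemma lincomb_inj : injective (lincomb F).
Proof.
move=> b c eq_bc; apply/eqP; rewrite -subr_eq0 addrC -scaleN1r; apply/eqP.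
by apply: (proj1 F_basis); rewrite lincomb_linear eq_bc scaleN1r addNr.
Qed.

Lemma coord_linear : linear coord.
Proof. by move=> a x y; apply: lincomb_inj; rewrite lincomb_linear !coordK. Qed.

HB.instance Definition _ := GRing.isLinear.Build 'F_p _ _ _ coord coord_linear.

Definition crd x i : 'F_p := (coord x)`_i.

Lemma coordB x y i : crd (x - y) i = crd x i - crd y i.
Proof. by rewrite /crd raddfB coefB. Qed.

Lemma coordZ a x i : crd (a *: x) i = a * crd x i.
Proof. by rewrite /crd linearZ coefZ. Qed.

Lemma coord_comb n (a : 'I_n -> 'F_p) (x : 'I_n -> {poly 'F_p}) i :
  crd (\sum_(j < n) a j *: x j) i = \sum_(j < n) a j * crd (x j) i.
Proof.
by rewrite /crd linear_sum coef_sum; apply: eq_bigr => j _; rewrite linearZ coefZ.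
Qed.

Lemma lex_ltP x y :
  lex_lt F x y <-> exists2 N, (crd x N < crd y N)%N &
                     forall i, (N < i)%N -> crd x i = crd y i.
Proof.
split=> [[cx] [cy] [-> -> [N [ltN eqN]]]|[N ltN eqN]].
  by exists N; rewrite /crd !(lincomb_inj (coordK _)) //.
by exists (coord x), (coord y); rewrite !coordK; split=> //; exists N.
Qed.

Lemma lex_lt_irrefl x : ~ lex_lt F x x.
Proof. by case/lex_ltP=> N; rewrite ltnn. Qed.

(** Reading the [F]-coordinates as base-p digits maps the order strictly into [nat]; asymmetry and
    descent are inherited from there. *)
Lemma lex_lt_rank : exists rk : {poly 'F_p} -> nat,
  forall x y, lex_lt F x y -> (rk x < rk y)%N.
Proof.
pose u x i := (crd x i * p ^ i)%N.
exists (fun x => \sum_(i < size (coord x)) u x i)%N => x y /lex_ltP[N ltN eqN].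
pose n := maxn (size (coord x)) (size (coord y)).
have ext z : (size (coord z) <= n)%N ->
    (\sum_(i < size (coord z)) u z i = \sum_(i < n) u z i)%N.
  move=> le_n; apply: (@big_ord_support _ _ addn (u z)) => i.
  by move/minn_idPl: le_n => -> /(nth_default 0); rewrite /u /crd => ->.
rewrite !ext ?leq_maxl ?leq_maxr //.
(* Past the size of [coord y] its coefficients are 0, and 0 exceeds no coordinate of [x]. *)
have ltNn : (N < n)%N.
  rewrite leq_max; apply/orP; right; rewrite ltnNge; apply/negP => leN.
  by move: ltN; rewrite [X in (_ < nat_of_ord X)%N]/crd nth_default.
apply: (@expansion_lex p n (fun i => crd x i) (fun i => crd y i) (Ordinal ltNn)) => //.
  by move=> i; apply: ltn_Fp.
by move=> i ltNi; rewrite eqN.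
Qed.

Lemma lex_lt_asym x y : lex_lt F x y -> ~ lex_lt F y x.
Proof.
have [rk rkP] := lex_lt_rank.
by move=> /rkP ltxy /rkP /(ltn_trans ltxy); rewrite ltnn.
Qed.

(** The largest differing index is the degree of the polynomial [coord (x - y)], whose leading
    coefficient is nonzero. *)
Lemma lex_lt_total x y : x <> y -> lex_lt F x y \/ lex_lt F y x.
Proof.
move=> ne_xy; pose dif := coord (x - y).
have dif0 : dif != 0.
  rewrite /dif raddfB subr_eq0; apply: contra_notN ne_xy => /eqP eq.
  by rewrite -[x]coordK eq coordK.
pose N := (size dif).-1.
have eqN i : (N < i)%N -> crd x i = crd y i.
  rewrite /N prednK ?size_poly_gt0 // => /(nth_default 0)/eqP.
  by rewrite -[_`_i]/(crd (x - y) i) coordB subr_eq0 => /eqP.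
have : crd x N != crd y N.
  by rewrite -subr_eq0 -coordB -[crd _ _]/(lead_coef dif) lead_coef_eq0.
rewrite -val_eqE neq_ltn => /orP[] ltN; [left|right]; apply/lex_ltP; exists N => //.
by move=> i /eqN ->.
Qed.

Lemma is_lex_min_exists (P : {poly 'F_p} -> Prop) :
  (exists x, P x) -> exists z, is_lex_min F P z.
Proof.
have [rk rkP] := lex_lt_rank => -[x].
have [n] := ubnP (rk x); elim: n x => // n IHn x; rewrite ltnS => le_n Px.
have [[y [Py /rkP lt_yx]]|min_x] :=
  excluded_middle_informative (exists y, P y /\ lex_lt F y x).
  exact: IHn (leq_trans lt_yx le_n) Py.
exists x; split=> // y Py ne_yx.
have [lt_yx|//] := lex_lt_total ne_yx.
by case: min_x; exists y.
Qed.

End Basis.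

(** * Hamming distance *)

Section Hamming.

Variable p : nat.
Implicit Types x y z : {poly 'F_p}.

Lemma hamming_widen x y n : (maxn (size x) (size y) <= n)%N ->
  hamming x y = (\sum_(i < n) (x`_i != y`_i)%R)%N.
Proof.
move=> le_n; rewrite /hamming cardsE -sum1_card big_mkcond /=.
transitivity (\sum_(i < maxn (size x) (size y)) (x`_i != y`_i)%R)%N.
  by apply: eq_bigr => i _; rewrite unfold_in; case: (_ != _).
apply: (@big_ord_support _ _ addn (fun i => (x`_i != y`_i)%R : nat)).
by move/minn_idPl: le_n => -> i; rewrite geq_max => /andP[? ?]; rewrite !nth_default ?eqxx.
Qed.

Lemma hamming_coef_eq x y x' y' :
  (forall i, (x`_i == y`_i) = (x'`_i == y'`_i)) -> hamming x y = hamming x' y'.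
Proof.
move=> eq_c; pose n := maxn (maxn (size x) (size y)) (maxn (size x') (size y')).
rewrite (@hamming_widen _ _ n) ?leq_maxl // (@hamming_widen x' _ n) ?leq_maxr //.
by apply: eq_bigr => i _; rewrite eq_c.
Qed.

Lemma hamming_sub0 x y : hamming x y = hamming (x - y) 0.
Proof. by apply: hamming_coef_eq => i; rewrite coefB coef0 subr_eq0. Qed.

Lemma hammingxx x : hamming x x = 0%N.
Proof.
by rewrite (hamming_widen (leqnn _)) big1 // => i _; rewrite eqxx.
Qed.

Lemma hammingZ0 a x : a != 0 -> hamming (a *: x) 0 = hamming x 0.
Proof.
by move=> a0; apply: hamming_coef_eq => i; rewrite coefZ coef0 mulf_eq0 (negPf a0).
Qed.

(** A word with [d] ones beyond the support of every member of [s] differs from each of them in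
    those places. *)
Lemma far_word_exists d (s : seq {poly 'F_p}) :
  exists z, forall y, y \in s -> (d <= hamming z y)%N.
Proof.
pose M := (\max_(y <- s) size y)%N.
pose z : {poly 'F_p} := \poly_(i < M + d) 1.
exists z => y ys.
have le_yM : (size y <= M)%N by rewrite /M (big_rem y) //= leq_maxl.
have le_n : (maxn (size z) (size y) <= M + d)%N.
  by rewrite geq_max size_poly (leq_trans le_yM) ?leq_addr.
rewrite (hamming_widen le_n) big_split_ord /= (leq_trans _ (leq_addl _ _)) //.
rewrite -[X in (X <= _)%N]card_ord -sum1_card leq_sum // => i _.
rewrite coef_poly ltn_add2l ltn_ord nth_default ?oner_neq0 //.
by rewrite (leq_trans le_yM) ?leq_addr.
Qed.

End Hamming.

(** * Lexicographic words and digit vectors *)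

Section LexWords.

Variables (p : nat) (p_prime : prime p) (F : nat -> {poly 'F_p}).
Hypothesis F_basis : ordered_basis F.
Variable d : nat.

Local Notation w := (lex_word F d).

Lemma mem_lex_words n y :
  reflect (exists2 b, (b < n)%N & y = w b) (y \in lex_words F d n).
Proof.
elim: n => [|n IHn] /=; first by constructor=> -[].
rewrite mem_rcons inE; apply: (iffP orP) => [[/eqP->|/IHn[b ltb ->]]|[b]].
- by exists n.
- by exists b => //; apply: ltnW.
rewrite ltnS leq_eqVlt => /predU1P[-> ->|ltb eq_y]; first by left.
by right; apply/IHn; exists b.
Qed.

(** The candidate set is inhabited by [far_word_exists], so it has a minimum and [epsilon] returns
    that minimum, not an arbitrary value. *)
Lemma lex_word_is_min a :
  is_lex_min F (fun z => forall b, (b < a)%N -> (d <= hamming z (w b))%N) (w a).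
Proof.
have [far min] : is_lex_min F
    (fun z => forall y, y \in lex_words F d a -> (d <= hamming z y)%N) (w a).
  by apply: epsilon_spec; apply: is_lex_min_exists => //; apply: far_word_exists.
split=> [b ltb|y fary]; first by apply: far; apply/mem_lex_words; exists b.
by apply: min => z /mem_lex_words[b /fary far_b ->].
Qed.

Lemma lex_word_far a b : (b < a)%N -> (d <= hamming (w a) (w b))%N.
Proof. by case: (lex_word_is_min a) => far _; apply: far. Qed.

Lemma lex_lt_word_near a z :
  lex_lt F z (w a) -> exists2 b, (b < a)%N & (hamming z (w b) < d)%N.
Proof.
move=> lt_z; have [b near|far] := pickP (fun b : 'I_a => (hamming z (w b) < d)%N).
  by exists b.
case: (lex_word_is_min a) => _ min; case: (lex_lt_asym p_prime F_basis lt_z).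
apply: min => [b ltb|eq_z].
  by have := far (Ordinal ltb); rewrite /= ltnNge => /negbFE.
by move: lt_z; rewrite eq_z => /(lex_lt_irrefl F_basis).
Qed.

Lemma lex_word_or_gt a z : (forall b, (b < a)%N -> (d <= hamming z (w b))%N) ->
  w a = z \/ lex_lt F (w a) z.
Proof.
case: (lex_word_is_min a) => _ min far.
have [->|/eqP ne_z] := eqVneq z (w a); first by left.
by right; apply: min.
Qed.

Hypothesis d_gt0 : (0 < d)%N.

Lemma lex_word_inj : injective w.
Proof.
move=> a b; wlog le_ab : a b / (a <= b)%N => [H|] eq_w.
  by case/orP: (leq_total a b) => ?; [|symmetry]; apply: H.
apply/eqP; rewrite eqn_leq le_ab leqNgt; apply/negP=> /lex_word_far.
by rewrite eq_w hammingxx leqn0 -leqn0 leqNgt d_gt0.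
Qed.

(** If [b <= a], then [w a] is among the candidates for [w b], and minimality of [w b] excludes
    [w a] from preceding it. *)
Lemma lex_word_lt a b : lex_lt F (w a) (w b) -> (a < b)%N.
Proof.
move=> lt_w; rewrite ltnNge; apply/negP=> le_ba.
have far c (ltc : (c < b)%N) := lex_word_far (leq_trans ltc le_ba).
have [eq_w|/(lex_lt_asym p_prime F_basis)//] := lex_word_or_gt far.
by move: lt_w; rewrite eq_w => /(lex_lt_irrefl F_basis).
Qed.

(** * Numbers below [p ^ k] as digit vectors *)

Variable k : nat.
Implicit Types c h e : 'rV['F_p]_k.

(** With digits kept in a row vector over F_p, digitwise addition mod p is vector addition; [num]
    and [dig] are inverse bijections between vectors and numbers below [p ^ k]. *)
Definition num c := (\sum_(i < k) c ord0 i * p ^ i)%N.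

Definition dig a : 'rV['F_p]_k := \row_i (digit p a i)%:R.

Lemma digE a i : dig a ord0 i = digit p a i :> nat.
Proof. by rewrite mxE val_Fp_nat // modn_mod. Qed.

Lemma num_lex c h (i : 'I_k) : (c ord0 i < h ord0 i)%N ->
  (forall j : 'I_k, (i < j)%N -> c ord0 j = h ord0 j) -> (num c < num h)%N.
Proof.
move=> lt_i eq_j; apply: (expansion_lex (N := i)) => // [j|j /eq_j -> //].
exact: ltn_Fp.
Qed.

Lemma last_diff c h : c != h -> exists i : 'I_k,
  c ord0 i != h ord0 i /\ forall j : 'I_k, (i < j)%N -> c ord0 j = h ord0 j.
Proof.
move=> ne_ch; have [i0 ne_i0] : exists i, c ord0 i != h ord0 i.
  apply/existsP; apply: contraR ne_ch; rewrite negb_exists => /forallP eq_ch.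
  by apply/eqP/rowP=> i; apply/eqP; have := eq_ch i; rewrite negbK.
case: (@arg_maxnP _ i0 (fun i => c ord0 i != h ord0 i) (fun i => i)) => // i ne_i max_i.
exists i; split=> // j lt_ij; apply/eqP; apply: contraTT lt_ij.
by rewrite -leqNgt; apply: max_i.
Qed.

Lemma num_inj : injective num.
Proof.
move=> c h eq_ch; apply/eqP; apply: contra_eqT eq_ch => /last_diff[i [ne_i eq_j]].
move: ne_i; rewrite -val_eqE neq_ltn => /orP[] lt_i.
  by rewrite ltn_eqF // (num_lex lt_i).
by rewrite gtn_eqF // (num_lex lt_i) // => j /eq_j.
Qed.

Lemma num_ltP c h : (num c < num h)%N -> exists i : 'I_k,
  (c ord0 i < h ord0 i)%N /\ forall j : 'I_k, (i < j)%N -> c ord0 j = h ord0 j.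
Proof.
move=> lt_ch; have /last_diff[i [ne_i eq_j]] : c != h.
  by apply: contraTneq lt_ch => ->; rewrite ltnn.
exists i; split=> //; move: ne_i; rewrite -val_eqE neq_ltn => /orP[] // lt_i.
move: lt_ch; rewrite ltnNge => /negP[]; apply: ltnW.
by apply: (num_lex lt_i) => j /eq_j.
Qed.

Lemma num_lt c : (num c < p ^ k)%N.
Proof. by apply: expansion_lt => i; apply: ltn_Fp. Qed.

Lemma digK a : (a < p ^ k)%N -> num (dig a) = a.
Proof.
move=> lta; rewrite -[RHS](modn_small lta) -expansion_mod.
by apply: eq_bigr => i _; rewrite digE.
Qed.

Lemma numK c : dig (num c) = c.
Proof. by apply: num_inj; rewrite digK ?num_lt. Qed.

Lemma leq_num c i : (c ord0 i * p ^ i <= num c)%N.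
Proof. by rewrite /num (bigD1 i) //= leq_addr. Qed.

Lemma num_delta i : num (delta_mx ord0 i) = (p ^ i)%N.
Proof.
rewrite /num (bigD1 i) //= big1 => [|j ne_ji]; rewrite mxE !eqxx /=.
  by rewrite addn0 modn_small ?mul1n.
by rewrite (negPf ne_ji).
Qed.

Lemma num_lt_exp c (i : 'I_k) :
  (num c < p ^ i)%N <-> forall j : 'I_k, (i <= j)%N -> c ord0 j = 0.
Proof.
split=> [lt_c j le_ij|c0].
  apply/val_inj/eqP; rewrite -leqn0 -ltnS; apply: contraTT lt_c.
  rewrite -!leqNgt => c_gt0; apply: leq_trans (leq_num c j).
  by rewrite -[X in (X <= _)%N]mul1n leq_mul ?leq_exp2l ?prime_gt1.
rewrite -num_delta; apply: (@num_lex _ _ i) => [|j lt_ij]; rewrite mxE !eqxx /=.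
  by rewrite c0.
by rewrite c0 ?(ltnW lt_ij) // -val_eqE gtn_eqF.
Qed.

(** This is w^+ read on digit vectors, where it becomes a linear map. *)
Definition comb c : {poly 'F_p} := \sum_(i < k) c ord0 i *: w (p ^ i).

Lemma comb_linear : linear comb.
Proof.
move=> a c h; rewrite /comb scaler_sumr -big_split; apply: eq_bigr => i _ /=.
by rewrite !mxE scalerDl scalerA.
Qed.

HB.instance Definition _ := GRing.isLinear.Build 'F_p _ _ _ comb comb_linear.

Lemma comb_delta i : comb (delta_mx ord0 i) = w (p ^ i).
Proof.
rewrite /comb (bigD1 i) //= big1 => [|j ne_ji]; rewrite mxE !eqxx /=.
  by rewrite scale1r addr0.
by rewrite (negPf ne_ji) scale0r.
Qed.

Lemma digit_gt a i : (minn a k <= i)%N -> (a < p ^ k)%N -> digit p a i = 0%N.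
Proof.
move=> le_i lta; rewrite /digit divn_small ?mod0n //.
have : (a < p ^ minn a k)%N.
  have [_|_] := leqP a k => //; exact: ltn_expl (prime_gt1 p_prime).
by move=> /leq_trans; apply; rewrite leq_exp2l ?prime_gt1.
Qed.

Lemma lex_word_plusE a : (a < p ^ k)%N -> lex_word_plus F d a = comb (dig a).
Proof.
move=> lta; transitivity (\sum_(i < k) (digit p a i)%:R *: w (p ^ i)).
  apply: (@big_ord_support _ 0 +%R (fun i => (digit p a i)%:R *: w (p ^ i))) => i le_i.
  by rewrite digit_gt ?scale0r.
by apply: eq_bigr => i _; rewrite mxE.
Qed.

Lemma digit_sumE a : (a < p ^ k)%N -> digit_sum p a = (\sum_(i < k) dig a ord0 i)%N.
Proof.
move=> lta; transitivity (\sum_(i < k) digit p a i)%N.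
  by apply: (@big_ord_support _ _ addn (digit p a)) => i le_i; rewrite digit_gt.
by apply: eq_bigr => i _; rewrite digE.
Qed.

(** * The strong induction towards w = w^+ *)

Definition linear_below m := forall c, (num c < m)%N -> w (num c) = comb c.

Lemma linear_below_le m n : (m <= n)%N -> linear_below n -> linear_below m.
Proof. by move=> le_mn lin c ltc; apply: lin; apply: leq_trans ltc le_mn. Qed.

Lemma word_exp_far (i : 'I_k) h : linear_below (p ^ i) ->
  (forall j : 'I_k, (i <= j)%N -> h ord0 j = 0) ->
  (d <= hamming (w (p ^ i)) (comb h))%N.
Proof. by move=> lin /num_lt_exp lt_h; rewrite -lin //; apply: lex_word_far. Qed.

Lemma comb_far c h : linear_below (num c) -> (num h < num c)%N ->
  (d <= hamming (comb c) (comb h))%N.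
Proof.
move=> lin /num_ltP[i [lt_i eq_j]]; pose a := c ord0 i - h ord0 i.
have a0 : a != 0 by rewrite subr_eq0 -val_eqE gtn_eqF.
(* Dividing [c - h] by [a] makes its top digit, at place [i], equal to 1. Subtracting from the unit
   vector cancels it, so [e] lives strictly below place [i]. *)
pose e := delta_mx ord0 i - a^-1 *: (c - h).
have e0 (j : 'I_k) : (i <= j)%N -> e ord0 j = 0.
  rewrite !mxE eqxx /= leq_eqVlt => /predU1P[/val_inj <-|lt_ij].
    by rewrite eqxx /= -/a mulVf ?subrr.
  by rewrite eq_j // subrr mulr0 -val_eqE gtn_eqF // subrr.
have eq_ch : c - h = a *: (delta_mx ord0 i - e).
  by rewrite subKr scalerA mulfV // scale1r.
rewrite hamming_sub0 -raddfB /= eq_ch linearZ /= hammingZ0 // raddfB /=.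
rewrite -hamming_sub0 comb_delta; apply: word_exp_far => //.
apply: linear_below_le lin; apply: leq_trans (leq_num c i).
by rewrite -[X in (X <= _)%N]mul1n leq_mul2r (leq_trans _ lt_i) ?orbT.
Qed.

(** By [comb_far], [comb c] is a candidate for the word numbered [num c], so that word equals
    [comb c] or precedes it. *)
Lemma linear_step c : linear_below (num c) ->
  ~ lex_lt F (w (num c)) (comb c) -> w (num c) = comb c.
Proof.
move=> lin not_lt; have far b : (b < num c)%N -> (d <= hamming (comb c) (w b))%N.
  move=> lt_b; have ltb : (b < p ^ k)%N by apply: ltn_trans lt_b (num_lt c).
  by rewrite -(digK ltb) lin ?comb_far ?digK.
by have [|/not_lt] := lex_word_or_gt far.
Qed.

Lemma linear_all :
  (forall c, linear_below (num c) -> ~ lex_lt F (w (num c)) (comb c)) ->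
  forall c, w (num c) = comb c.
Proof.
move=> step c; have [n] := ubnP (num c); elim: n c => // n IHn c; rewrite ltnS => le_n.
have lin : linear_below (num c).
  by move=> e lt_e; apply: IHn; apply: leq_trans lt_e le_n.
by apply: linear_step; auto.
Qed.

(** List each index [i] with multiplicity [c ord0 i] and apply [short_subseq_sum]; the
    multiplicities in the short subsequence are the digits of [b]. *)
Lemma short_subvector c (g : 'I_k -> 'F_p) : exists b : 'rV['F_p]_k,
  [/\ forall i, (b ord0 i <= c ord0 i)%N, (\sum_(i < k) b ord0 i < p)%N &
      \sum_(i < k) b ord0 i * g i = \sum_(i < k) c ord0 i * g i].
Proof.
pose s := flatten [seq nseq (c ord0 i) i | i <- enum 'I_k].
have count_s i : count_mem i s = c ord0 i.
  rewrite /s count_flatten -map_comp sumnE big_map -[LHS]/(\sum_(j <- enum 'I_k) _)%N.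
  rewrite big_enum /= (bigD1 i) //= count_nseq /= eqxx mul1n big1 ?addn0 // => j.
  by rewrite count_nseq /= => /negPf->.
have sum_count (t : seq 'I_k) (f : 'I_k -> 'F_p) :
    \sum_(i <- t) f i = \sum_(i < k) (count_mem i t)%:R * f i.
  elim: t => [|i t IHt]; first by rewrite big_nil big1 // => i _; rewrite mul0r.
  rewrite big_cons IHt [RHS](bigD1 i) //= [in LHS](bigD1 i) //= eqxx natrD mulrDl mul1r -addrA.
  congr (_ + (_ + _)); apply: eq_bigr => j /negPf ne_j.
  by rewrite eq_sym ne_j.
have [t [sub_t lt_t sum_t]] := short_subseq_sum p_prime g s.
have le_t i : (count_mem i t <= c ord0 i)%N by rewrite -count_s leq_count_subseq.
pose b : 'rV['F_p]_k := \row_i (count_mem i t)%:R.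
(* The count is at most a digit of [c], hence below [p], so casting it to F_p loses nothing. *)
have bE i : b ord0 i = count_mem i t :> nat.
  by rewrite mxE val_Fp_nat // modn_small // (leq_ltn_trans (le_t i)) // ltn_Fp.
exists b; split=> [i||]; first by rewrite bE.
  rewrite (eq_bigr _ (fun i _ => bE i)); apply: leq_ltn_trans lt_t.
  rewrite -[X in (_ <= X)%N]sum1_size.
  have -> : (\sum_(j <- t) 1 = \sum_(i < k) count_mem i t)%N; last by [].
  elim: t {sub_t sum_t le_t b bE} => [|j t IHt]; first by rewrite big_nil big1.
  rewrite big_cons IHt big_split /=; congr addn.
  rewrite (bigD1 j) //= eqxx big1 // => i.
  by rewrite eq_sym => /negPf->.
rewrite (eq_bigr (fun i => (count_mem i t)%:R * g i)) => [|i _]; last by rewrite mxE.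
rewrite -sum_count sum_t sum_count; apply: eq_bigr => i _.
by rewrite count_s natr_Zp.
Qed.

(** * Conditions (3) and (1) each imply condition (2) *)

Local Notation crd := (crd F_basis).

Lemma linear_of_small :
  (forall c, (\sum_(i < k) c ord0 i < p)%N -> w (num c) = comb c) ->
  forall c, w (num c) = comb c.
Proof.
move=> small; apply: linear_all => c lin /(lex_ltP F_basis)[N ltN eqN].
have [b [le_bc lt_b sum_b]] := short_subvector c (fun i => crd (w (p ^ i)) N).
have crd_bN : crd (comb b) N = crd (comb c) N by rewrite !coord_comb.
(* By the choice of [b], [comb (c - b)] has [N]-th coordinate 0, so the subtraction keeps the
   deficit at [N]; above [N] the two sides agree. *)
have : lex_lt F (w (num c) - comb (c - b)) (w (num b)).
  rewrite (small b) //; apply/(lex_ltP F_basis); exists N => [|i /eqN eqi].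
    by rewrite raddfB !coordB crd_bN subrr subr0.
  by rewrite raddfB !coordB eqi subKr.
case/lex_lt_word_near=> b' lt_b'; have lt_b'k := ltn_trans lt_b' (num_lt b).
move: lt_b'; rewrite -(digK lt_b'k); move: (dig b') => h lt_h.
have le_num : (num b <= num c)%N by apply: leq_sum => i _; rewrite leq_mul2r le_bc orbT.
rewrite (lin h) ?(leq_trans lt_h) // hamming_sub0.
(* At the top place where [h] and [b] differ, the integer digit [c - b + h] is below that of [c],
   and reduction mod p can only lower it. Above that place the digits are those of [c]. *)
have lt_e : (num (c - b + h) < num c)%N.
  have [i [lt_i eq_j]] := num_ltP lt_h.
  apply: (num_lex (i := i)) => [|j /eq_j eqj]; rewrite !mxE; last by rewrite eqj subrK.
  apply: leq_ltn_trans (Fp_valD_le p_prime _ _) _; rewrite Fp_valB //.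
  by rewrite -ltn_subRL subKn.
rewrite -addrA -opprD -raddfD /= -hamming_sub0 -(lin _ lt_e) ltnNge => /negP[].
exact: lex_word_far.
Qed.

Lemma linear_of_closed :
  (forall (a : 'F_p) (b c : nat), (b < p ^ k)%N -> (c < p ^ k)%N ->
     exists2 e, (e < p ^ k)%N & a *: w b + w c = w e) ->
  forall c, w (num c) = comb c.
Proof.
move=> closed; pose C x := exists2 e, (e < p ^ k)%N & x = w e.
have C_lin a x y : C x -> C y -> C (a *: x + y).
  by move=> [b ltb ->] [c ltc ->]; apply: closed.
have pk_gt0 : (0 < p ^ k)%N by rewrite expn_gt0 prime_gt0.
have C0 : C 0.
  by have := C_lin (-1) (w 0) (w 0); rewrite scaleN1r addNr; apply; exists 0%N.
have Cexp (i : 'I_k) : C (w (p ^ i)) by exists (p ^ i)%N; rewrite ?ltn_exp2l ?prime_gt1.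
have Ccomb c : C (comb c).
  by rewrite /comb; elim/big_rec: _ => // i x _ Cx; apply: C_lin.
apply: linear_all => c lin /(lex_ltP F_basis)[N ltN eqN].
pose y := w (num c) - comb c; pose u := crd y N.
have Cy : C y.
  rewrite /y addrC -scaleN1r; apply: C_lin => //.
  by exists (num c); rewrite ?num_lt.
have y0 i : (N < i)%N -> crd y i = 0 by move=> /eqN eqi; rewrite coordB eqi subrr.
have u0 : u != 0 by rewrite /u coordB subr_eq0 -val_eqE ltn_eqF.
pose g (j : 'I_k) := crd (w (p ^ j)) N.
have crd_combN e : crd (comb e) N = \sum_(i < k) e ord0 i * g i by rewrite coord_comb.
(* Since [u^-1 *: y] has [N]-th coordinate 1 and none above, [x] has [N]-th coordinate [g j - 1] and
   precedes [w (p ^ j)]. As a codeword it is then some [w b] with [b < p ^ j], and solving for [y]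
   gives [e]. *)
have combP (j : 'I_k) : (p ^ j <= num c)%N -> g j != 0 ->
    exists e, [/\ y = comb e, e ord0 j = u & forall l : 'I_k, (j < l)%N -> e ord0 l = 0].
  move=> le_j gj0; pose x := w (p ^ j) - u^-1 *: y.
  have lt_x : lex_lt F x (w (p ^ j)).
    apply/(lex_ltP F_basis); exists N => [|i lt_i]; rewrite coordB coordZ.
      by rewrite mulVf //; apply: Fp_valB1.
    by rewrite y0 // mulr0 subr0.
  have [b ltb eq_x] : C x by rewrite /x addrC -scaleNr; apply: C_lin.
  have lt_b : (b < p ^ j)%N by apply: lex_word_lt; rewrite -eq_x.
  move: eq_x lt_b; rewrite -(digK ltb); move: (dig b) => h eq_x lt_h.
  have h0 := proj1 (num_lt_exp h j) lt_h.
  exists (u *: (delta_mx ord0 j - h)); split=> [||l lt_jl].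
  - rewrite linearZ /= raddfB /= comb_delta -lin ?(leq_trans lt_h) // -eq_x.
    by rewrite subKr scalerA mulfV // scale1r.
  - by rewrite !mxE !eqxx h0 // subr0 mulr1.
  by rewrite !mxE eqxx h0 ?(ltnW lt_jl) // -val_eqE gtn_eqF // subr0 mulr0.
(* For [i < j], both [ei] and [ej] represent [y], so [comb f] is [w (p ^ j)]. But the digits of [f]
   vanish from [j] on, which would put [w (p ^ j)] at distance at least [d] from itself. *)
have g_uniq (i j : 'I_k) : (p ^ i <= num c)%N -> (p ^ j <= num c)%N ->
    g i != 0 -> g j != 0 -> ~ (i < j)%N.
  move=> le_i le_j gi0 gj0 lt_ij.
  have [ei [eq_yi _ ei0]] := combP i le_i gi0.
  have [ej [eq_yj ejj ej0]] := combP j le_j gj0.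
  pose f := delta_mx ord0 j - u^-1 *: (ej - ei).
  have comb_f : comb f = w (p ^ j).
    rewrite /f raddfB /= linearZ /= raddfB /= -eq_yi -eq_yj.
    by rewrite subrr scaler0 subr0 comb_delta.
  suff : (d <= hamming (w (p ^ j)) (comb f))%N.
    by rewrite comb_f hammingxx leqNgt d_gt0.
  apply: word_exp_far => [|l]; first exact: linear_below_le lin.
  rewrite !mxE eqxx leq_eqVlt => /predU1P[/val_inj <-|lt_jl].
    by rewrite eqxx ejj ei0 // subr0 mulVf // subrr.
  by rewrite ej0 // ei0 ?(ltn_trans lt_ij) // subrr mulr0 -val_eqE gtn_eqF // subr0.
have le_exp i : c ord0 i != 0 -> (p ^ i <= num c)%N.
  move=> ci0; apply: leq_trans (leq_num c i).
  by rewrite -[X in (X <= _)%N]mul1n leq_mul2r lt0n orbC -val_eqE in ci0 *; rewrite ci0.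
(* Otherwise [comb c] would have [N]-th coordinate 0, yet by [ltN] this coordinate exceeds
   another. *)
have [j /andP[cj0 gj0]] : exists j, (c ord0 j != 0) && (g j != 0).
  apply/existsP; apply: contraLR ltN; rewrite negb_exists => /forallP cg0.
  rewrite crd_combN big1 // => i _; apply/eqP; rewrite mulf_eq0.
  by have := cg0 i; rewrite negb_and !negbK.
have le_j := le_exp j cj0.
have g0 i : i != j -> (p ^ i <= num c)%N -> g i = 0.
  move=> ne_ij le_i; apply/eqP; apply: contraT => gi0; move: ne_ij.
  by rewrite -val_eqE neq_ltn => /orP[] lt; [case: (g_uniq i j)|case: (g_uniq j i)].
have [e [eq_y ej e0]] := combP j le_j gj0.
(* Compare [N]-th coordinates in [y = comb e]: places above [j] drop out because [e] vanishes there,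
   places below because [g] does, leaving [u = u * g j]. *)
have gj1 : g j = 1.
  apply: (mulfI u0); rewrite mulr1 [in RHS]/u eq_y crd_combN (bigD1 j) //= ej.
  rewrite big1 ?addr0 // => i ne_ij; have [lt_ji|le_ij] := ltnP j i.
    by rewrite e0 ?mul0r.
  by rewrite g0 ?mulr0 // (leq_trans _ le_j) // leq_exp2l ?prime_gt1.
have crd_c : crd (comb c) N = c ord0 j.
  rewrite crd_combN (bigD1 j) //= gj1 mulr1 big1 ?addr0 // => i ne_ij.
  by have [->|/le_exp/(g0 i ne_ij) ->] := eqVneq (c ord0 i) 0; rewrite ?mul0r ?mulr0.
(* The digit of [c + e] at [j] is the [N]-th coordinate of [w (num c)], which is below
   [crd (comb c) N], that is, below the digit of [c]. *)
have lt_ce : (num (c + e) < num c)%N.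
  apply: (num_lex (i := j)) => [|i lt_ji]; rewrite mxE; last by rewrite e0 ?addr0.
  by rewrite ej /u coordB -crd_c addrC subrK.
have /lex_word_inj eq_num : w (num (c + e)) = w (num c).
  by rewrite lin // raddfD /= -eq_y /y addrC subrK.
by rewrite eq_num ltnn in lt_ce.
Qed.

End LexWords.

(** * From digit vectors back to natural numbers and codes *)

Theorem theorem1p4 (p : nat) (p_prime : prime p) (d : nat) (d_ge2 : (2 <= d)%N)
    (F : nat -> {poly 'F_p}) (F_basis : ordered_basis F) (k : nat) :
  (linear_code (mem (lex_code F d k)) <->
     (forall a : nat, (a < p ^ k)%N -> lex_word F d a = lex_word_plus F d a)) /\
  ((forall a : nat, (a < p ^ k)%N -> lex_word F d a = lex_word_plus F d a) <->
     (forall a : nat, (a < p ^ k)%N -> (digit_sum p a <= p - 1)%N ->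
        lex_word F d a = lex_word_plus F d a)).
Proof.
have d_gt0 : (0 < d)%N by apply: ltnW.
have linP : (forall c : 'rV['F_p]_k, lex_word F d (num c) = comb F d c) ->
    forall a, (a < p ^ k)%N -> lex_word F d a = lex_word_plus F d a.
  by move=> lin a lta; rewrite (lex_word_plusE p_prime F d lta) -lin digK.
have codeP x :
    reflect (exists2 a, (a < p ^ k)%N & x = lex_word F d a) (x \in lex_code F d k).
  apply: (iffP mapP) => -[a]; rewrite ?mem_iota => lta ->; exists a => //.
  by rewrite mem_iota.
split; [split=> [[_ closed]|lin] | split=> [lin a lta _|small]].
- apply/linP/linear_of_closed => // a b c ltb ltc.
  by apply/codeP/closed; apply/codeP; [exists b|exists c].
(* Under condition (2) the code is the image of the linear map [comb], hence a subspace. *)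
- have codeE x : reflect (exists c : 'rV['F_p]_k, x = comb F d c) (x \in lex_code F d k).
    apply: (iffP (codeP x)) => [[a lta ->]|[c ->]].
      by exists (dig p k a); rewrite lin // (lex_word_plusE p_prime F d lta).
    exists (num c); first exact: num_lt.
    by rewrite lin ?num_lt // (@lex_word_plusE _ p_prime _ _ k) ?num_lt // numK.
  split=> [|a x y /codeE[b ->] /codeE[c ->]]; apply/codeE.
    by exists 0; rewrite raddf0.
  by exists (a *: b + c); rewrite linearP.
- exact: lin.
apply/linP/linear_of_small => // c lt_c; have lt_num := num_lt p_prime c.
rewrite small ?(lex_word_plusE p_prime F d lt_num) ?numK //.
by rewrite (digit_sumE p_prime lt_num) numK // -ltnS subn1 prednK ?prime_gt0.
Qed.
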